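(* Let $\Sigma=(X,U,F)$ be a system and $Q\subset X$. If $(\mathcal{A},G)$ is a quasi-invariant-partition of $Q$, then \[\log\rho(W_{\mathcal{A},G})-\log\rho(M_{\mathcal{A},G})\le h_{inv}(\mathcal{A},G)\le\min\{\log\|W_{\mathcal{A},G}\|_\infty,\ \log\rho(W_{\mathcal{A},G})\},\] where $\rho(\cdot)$ denotes the spectral radius. In particular, if $\rho(M_{\mathcal{A},G})=1$, then $h_{inv}(\mathcal{A},G)=\log\rho(W_{\mathcal{A},G})$.
   Context: A system is a triple $\Sigma=(X,U,F)$ where $X,U$ are nonempty sets and $F:X\times U\rightrightarrows X$ is a set-valued map with $F(x,u)\neq\emptyset$ for all $(x,u)$; for $A\subset X$, $F(A,u)=\bigcup_{x\in A}F(x,u)$. An invariant cover of $Q$ is a pair $(\mathcal{A},G)$ where $\mathcal{A}$ is a finite cover of $Q$ (by subsets of $Q$) and $G:\mathcal{A}\to U$ satisfies $F(A,G(A))\subset Q$ for all $A\in\mathcal{A}$. For $\mathcal{S}\subset\mathcal{A}^n$, $\alpha=\alpha(0)\cdots\alpha(n-1)\in\mathcal{S}$ and integer $0\le t<n-1$, let $P(\alpha|_{[0,t]})=\{A\in\mathcal{A}:\exists\hat\alpha\in\mathcal{S},\ \hat\alpha|_{[0,t]}=\alpha|_{[0,t]},\ A=\hat\alpha(t+1)\}$, and $P(\alpha|_{[0,n-1]})=P(\alpha)=\{\hat\alpha(0):\hat\alpha\in\mathcal{S}\}$. $\mathcal{S}$ is $(n,Q)$-spanning in $(\mathcal{A},G)$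 if (1) the elements of $P(\alpha)$ cover $Q$, and (2) for every $\alpha\in\mathcal{S}$ and $0\le t<n-1$, $F(\alpha(t),G(\alpha(t)))\subset\bigcup_{A'\in P(\alpha|_{[0,t]})}A'$. Let $N(\mathcal{S})=\max_{\alpha\in\mathcal{S}}\prod_{t=0}^{n-1}\sharp P(\alpha|_{[0,t]})$, $r_{inv}(n,Q,\mathcal{A},G)=\min\{N(\mathcal{S}):\mathcal{S}\ (n,Q)\text{-spanning in }(\mathcal{A},G)\}$, and $h_{inv}(\mathcal{A},G)=\lim_{n\to\infty}\frac1n\log r_{inv}(n,Q,\mathcal{A},G)$ ($\log$ base $2$). For $A\in\mathcal{A}$: $D(A)=\{A'\in\mathcal{A}:F(A,G(A))\cap A'\neq\emptyset\}$. An invariant cover $(\mathcal{A},G)$ is a quasi-invariant-partition of $Q$ if $A\setminus\bigcup_{B\in\mathcal{A},B\neq A}B\neq\emptyset$ for all $A\in\mathcal{A}$, and $F(A,G(A))\cap\big(B\setminus\bigcup_{C\in D(A),C\neq B}C\big)\neq\emptyset$ for all $A\in\mathcal{A}$ and $B\in D(A)$. The adjacency matrix $M_{\mathcal{A},G}=(M_{AB})_{A,B\in\mathcal{A}}$ has $M_{AB}=1$ if $F(A,G(A))\cap B\neq\emptyset$ and $0$ otherwise; the weighted adjacency matrix $W_{\mathcal{A},G}=(W_{AB})_{A,B\in\mathcal{A}}$ has $W_{AB}=\sharp D(A)$ if $F(A,G(A))\cap B\neq\emptyset$ and $0$ otherwise. For a square matrix $M=(a_{ij})$, $\|M\|_\infty=\max_{i,j}|a_{ij}|$.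 *)

(* Defs.v *)
From Stdlib Require Import Reals.
From HB Require Import structures.
From mathcomp Require Import all_boot all_order all_algebra.
From mathcomp Require Import complex.
From mathcomp Require Import boolp classical_sets reals topology normedtype sequences.
From mathcomp Require Import Rstruct Rstruct_topology.

Set Implicit Arguments.
Unset Strict Implicit.
Unset Printing Implicit Defensive.

Import Order.TTheory GRing.Theory Num.Theory.

Local Open Scope classical_set_scope.
Local Open Scope ring_scope.

Definition log2 (x : R) : R := (ln x / ln 2)%R.

Definition spectral_radius (n : nat) (M : 'M[R]_n) : R :=
  sup [set ComplexField.Normc.normc z | z in [set z : R[i] | eigenvalue (map_mx (real_complex R) M) z]].

Definition mx_norm_inf (n : nat) (M : 'M[R]_n) : R :=
  \big[Num.max/0]_(i < n) \big[Num.max/0]_(j < n) `|M i j|.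

Section Systems.
Variables (X U : Type) (F : X -> U -> set X).
Variables (I : finType) (cov : I -> set X) (G : I -> U).

Definition Fimg (A : I) : set X :=
  [set y | exists x, cov A x /\ F x (G A) y].

(** (A,G) is an invariant cover of Q ; the cover {cov A | A : I} is a finite
    set of subsets of Q (cov injective) covering Q. *)
Definition invariant_cover (Q : set X) : Prop :=
  injective cov /\
  (forall A, cov A `<=` Q) /\
  (Q `<=` \bigcup_(A in [set: I]) cov A) /\
  (forall A, Fimg A `<=` Q).

Definition Dset (A : I) : {set I} :=
  [set B | `[< exists y, Fimg A y /\ cov B y >] ]%SET.

Definition quasi_invariant_partition (Q : set X) : Prop :=
  invariant_cover Q /\
  (forall A, exists x, cov A x /\ forall B, B <> A -> ~ cov B x) /\
  (forall A B, B \in Dset A ->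
     exists y, Fimg A y /\ cov B y /\
       forall C, C \in Dset A -> C <> B -> ~ cov C y).

Definition adj_mx : 'M[R]_#|I| :=
  \matrix_(i, j) (if enum_val j \in Dset (enum_val i) then 1 else 0).

Definition wadj_mx : 'M[R]_#|I| :=
  \matrix_(i, j) (if enum_val j \in Dset (enum_val i)
                  then (#|Dset (enum_val i)|)%:R else 0).

(** Words alpha = alpha(0)...alpha(n-1) in A^n are n-tuples.
    P(alpha|[0,t]) for 0 <= t < n-1, and P(alpha|[0,n-1]) = P(alpha). *)
Definition Pset (n : nat) (S : {set n.-tuple I}) (a : n.-tuple I) (t : nat)
  : {set I} :=
  if (t.+1 < n)%N then
    [set A | [exists b in S, (take t.+1 b == take t.+1 a) && (nth A b t.+1 == A)]]%SET
  else [set A | [exists b in S, nth A b 0 == A]]%SET.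

Definition spanning (Q : set X) (n : nat) (S : {set n.-tuple I}) : Prop :=
  (forall a : n.-tuple I,
      Q `<=` \bigcup_(A in [set A | A \in Pset S a n.-1]) cov A) /\
  (forall a, a \in S -> forall t : 'I_n, (t.+1 < n)%N ->
      Fimg (tnth a t) `<=` \bigcup_(A in [set A | A \in Pset S a t]) cov A).

Definition Nspan (n : nat) (S : {set n.-tuple I}) : nat :=
  \max_(a in S) \prod_(t < n) #|Pset S a t|.

Definition r_inv (Q : set X) (n : nat) : R :=
  inf [set x : R | exists S : {set n.-tuple I}, spanning Q S /\ x = (Nspan S)%:R].

(** the sequence (1/n) log r_inv(n), n >= 1 (shifted to start at index 0) *)
Definition h_seq (Q : set X) (n : nat) : R :=
  log2 (r_inv Q n.+1) / (n.+1)%:R.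

Definition h_inv (Q : set X) : R := lim (h_seq Q @ \oo).

End Systems.

(* Main.v *)
(* The partition conditions force every spanning set to contain all walks of the
   graph A -> D(A), and the set of all walks is itself spanning. Hence
   r_inv(n+1) = #I * p_n, where p_n is the largest product of out-degrees along a
   walk of length n. The sequence p is submultiplicative, so by Fekete's lemma
   h = lim log2 (p_n) / n exists, and lam = 2^h satisfies lam^n <= p_n.

   Let w_n(A) and m_n(A) be the row sums of W^n and M^n, and v_n(A) the best weight
   of a walk of length n from A. Then v_n <= w_n <= v_n * m_n. Row sums of powers of
   a nonnegative matrix grow at most like r^n for every r above the spectral radius
   (Cayley-Hamilton), and bound |z|^n for every eigenvalue z; comparing growth rates
   gives lam <= rho(W) <= lam * rho(M). *)
Require Import Defs.
From Stdlib Require Import Reals.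
From HB Require Import structures.
From mathcomp Require Import all_boot all_order all_algebra.
From mathcomp Require Import complex.
From mathcomp Require Import boolp classical_sets reals topology normedtype sequences.
From mathcomp Require Import Rstruct Rstruct_topology.
From mathcomp Require Import ring lra.
Import Order.TTheory GRing.Theory Num.Theory.
Local Open Scope classical_set_scope.
Local Open Scope ring_scope.

Set Implicit Arguments.
Unset Strict Implicit.

Local Notation normc := ComplexField.Normc.normc.
Local Notation toC := (map_mx (real_complex R)).
Local Notation orbit A u n := (iter n (mulmx A) u).

(** * Complex moduli and the orbits of a vector under a matrix *)

Lemma normc_real (x : R) : normc (real_complex R x) = `|x|.
Proof. by rewrite /= expr0n addr0 sqrtr_sqr. Qed.

Lemma normc_ge0 (z : R[i]) : 0 <= normc z.
Proof. by case: z => a b; exact: sqrtr_ge0. Qed.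

Lemma normc_gt0 (z : R[i]) : z != 0 -> 0 < normc z.
Proof.
move=> z0; rewrite lt_neqAle normc_ge0 andbT eq_sym.
by apply: contra z0 => /eqP/ComplexField.Normc.eq0_normc ->.
Qed.

Lemma normc_sum (J : finType) (f : J -> R[i]) :
  normc (\sum_j f j) <= \sum_j normc (f j).
Proof.
elim/big_ind2: _ => //; first by rewrite ComplexField.Normc.normc0.
move=> x1 x2 y1 y2 h1 h2; apply: le_trans (le_normcD _ _) _; exact: lerD.
Qed.

Lemma toC_orbit m (A : 'M[R]_m) (u : 'cV[R]_m) n :
  toC (orbit A u n) = orbit (toC A) (toC u) n.
Proof. by elim: n => //= n IH; rewrite map_mxM IH. Qed.

Lemma orbit_ge0 m (A : 'M[R]_m) (u : 'cV[R]_m) n :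
  (forall i j, 0 <= A i j) -> (forall i, 0 <= u i 0) ->
  forall i, 0 <= orbit A u n i 0.
Proof.
move=> A0 u0; elim: n => //= n IH i.
by rewrite mxE sumr_ge0 // => j _; rewrite mulr_ge0.
Qed.

(* Peeling one root [z] off the annihilating polynomial replaces [u] by
   [B u - z u], and B^(n+1) u = z B^n u + B^n (B u - z u). *)
Lemma annihilated_orbit_growth m (B : 'M[R[i]]_m.+1) (s : seq R[i]) (rho r : R)
    (u : 'cV[R[i]]_m.+1) :
  0 <= rho -> rho < r -> (forall z, z \in s -> normc z <= rho) ->
  horner_mx B (\prod_(z <- s) ('X - z%:P)) *m u = 0 ->
  exists2 K, 0 <= K & forall n i, normc (orbit B u n i 0) <= K * r ^+ n.
Proof.
move=> rho0 rho_r; elim: s u => [|z s IH] u s_le.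
  rewrite big_nil rmorph1 mul1mx => ->; exists 0 => // n i.
  suff -> : orbit B (0 : 'cV_m.+1) n = 0 by rewrite mxE ComplexField.Normc.normc0 mul0r.
  by elim: n => //= n ->; rewrite mulmx0.
rewrite big_cons mulrC rmorphM rmorphB /= horner_mx_X horner_mx_C -mulmxA => u_ann.
have [|K K0 HK] := IH ((B - z%:M) *m u) _ u_ann.
  by move=> w ws; apply: s_le; rewrite in_cons ws orbT.
have z_le : normc z <= rho by apply: s_le; rewrite mem_head.
have step n : orbit B u n.+1 = z *: orbit B u n + orbit B ((B - z%:M) *m u) n.
  elim: n => [|n IHn]; first by rewrite /= mulmxBl mul_scalar_mx addrC subrK.
  by rewrite iterS {1}IHn mulmxDr -scalemxAr -!iterS.
pose K0' := \sum_i normc (u i 0).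
(* The induction needs [rho * K1 + K <= r * K1], that is [K <= K1 * (r - rho)], which the second
   summand secures; the first one covers [n = 0]. *)
pose K1 := K0' + K / (r - rho).
have d0 : 0 < r - rho by rewrite subr_gt0.
have K0'0 : 0 <= K0' by rewrite sumr_ge0 // => i _; exact: normc_ge0.
have K10 : 0 <= K1 by rewrite addr_ge0 // divr_ge0 // ltW.
have r0 : 0 <= r by apply: le_trans (ltW rho_r).
exists K1 => //; elim=> [|n IHn] i.
  rewrite expr0 mulr1 /=; apply: (@le_trans _ _ K0'); last first.
    by rewrite lerDl divr_ge0 // ltW.
  rewrite /K0' (bigD1 i) //= lerDl sumr_ge0 // => j _; exact: normc_ge0.
rewrite step !mxE; apply: le_trans (le_normcD _ _) _.
rewrite ComplexField.Normc.normcM.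
apply: (@le_trans _ _ (rho * (K1 * r ^+ n) + K * r ^+ n)).
  apply: lerD => //; apply: ler_pM => //; exact: normc_ge0.
rewrite exprS mulrA mulrA -mulrDl [K1 * r]mulrC ler_wpM2r ?exprn_ge0 //.
have -> : K = K / (r - rho) * (r - rho) by rewrite divfK // gt_eqF.
have : K / (r - rho) * (r - rho) <= K1 * (r - rho).
  by rewrite ler_wpM2r ?(ltW d0) // lerDr.
lra.
Qed.

(** * Spectral radius of a nonnegative matrix *)

Definition eigenmoduli m (M : 'M[R]_m) : set R :=
  [set normc z | z in [set z : R[i] | eigenvalue (toC M) z]].

(* |z| |v| <= |v| A entrywise for a left eigenvector v; iterate. *)
Lemma eigenvalue_orbit_le m (A : 'M[R]_m) (z : R[i]) n (b : R) :
  (forall i j, 0 <= A i j) -> eigenvalue (toC A) z ->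
  (forall i, orbit A (const_mx 1 : 'cV_m) n i 0 <= b) -> normc z ^+ n <= b.
Proof.
move=> A0 /eigenvalueP[v vA v0] le_b.
pose a : 'rV[R]_m := \row_i normc (v 0 i).
have a0 i : 0 <= a 0 i by rewrite mxE normc_ge0.
have aA j : normc z * a 0 j <= (a *m A) 0 j.
  rewrite mxE -ComplexField.Normc.normcM.
  have -> : z * v 0 j = \sum_i v 0 i * real_complex R (A i j).
    move/matrixP/(_ 0 j): vA; rewrite !mxE => <-.
    by apply: eq_bigr => i _; rewrite mxE.
  rewrite mxE; apply: le_trans (normc_sum _) _; apply: ler_sum => i _.
  by rewrite ComplexField.Normc.normcM normc_real ger0_norm // mxE.
have aAn (u : 'cV[R]_m) : (forall i, 0 <= u i 0) ->
    normc z ^+ n * (a *m u) 0 0 <= (a *m orbit A u n) 0 0.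
  elim: n u {le_b} => [|n IHn] u u0; first by rewrite expr0 mul1r.
  rewrite iterSr; apply: le_trans (IHn _ _); last first.
    by move=> i; apply: (@orbit_ge0 _ _ _ 1).
  rewrite exprSr -mulrA ler_wpM2l ?exprn_ge0 ?normc_ge0 // mulmxA !mxE mulr_sumr.
  by apply: ler_sum => j _; rewrite mulrA ler_wpM2r.
have sum_a : 0 < \sum_i a 0 i.
  have [j vj] : exists j, v 0 j != 0.
    by apply/existsP; apply: contraNT v0 => /existsPn v0; apply/eqP/rowP => j;
      rewrite mxE; apply/eqP; have := v0 j; rewrite negbK.
  rewrite (bigD1 j) //= ltr_pwDl ?sumr_ge0 // mxE; exact: normc_gt0.
(* Against the all-ones vector the left side is [normc z ^+ n] times the sum of [a], and the right
   side is at most [b] times that sum, which is positive and cancels. *)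
have := aAn (const_mx 1).
have -> : (a *m const_mx 1 : 'M_1) 0 0 = \sum_i a 0 i.
  by rewrite mxE; apply: eq_bigr => i _; rewrite [const_mx _ _ _]mxE mulr1.
move=> H; rewrite -(ler_pM2r sum_a); apply: le_trans (H _) _.
  by move=> i; rewrite mxE.
by rewrite mxE mulr_sumr; apply: ler_sum => i _; rewrite mulrC ler_wpM2r.
Qed.

(** Makes the supremum in [spectral_radius] meaningful. The row sums of [A] bound the eigenvalues
    (case [n = 1] of [eigenvalue_orbit_le]), and the characteristic polynomial has a root because
    its degree is positive. *)
Lemma has_sup_eigenmoduli m (A : 'M[R]_m) :
  (0 < m)%N -> (forall i j, 0 <= A i j) -> has_sup (eigenmoduli A).
Proof.
case: m A => // m A _ A0; split; last first.
  exists (\sum_i orbit A (const_mx 1 : 'cV_m.+1) 1 i 0) => _ [z /= zA <-].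
  rewrite -[normc z]expr1; apply: (eigenvalue_orbit_le A0 zA) => i.
  rewrite [leRHS](bigD1 i) //= lerDl sumr_ge0 // => j _.
  by apply: (@orbit_ge0 _ _ _ 1) => // k; rewrite mxE.
have [s Es] := closed_field_poly_normal (char_poly (toC A)).
have : size (char_poly (toC A)) = m.+2 by rewrite size_char_poly.
rewrite Es (monicP (char_poly_monic _)) scale1r size_prod_XsubC => -[].
case: s Es => // z s Es _; exists (normc z), z => //=.
rewrite eigenvalue_root_char Es (monicP (char_poly_monic _)) scale1r.
by rewrite root_prod_XsubC mem_head.
Qed.

Lemma normc_le_spectral_radius m (A : 'M[R]_m) z :
  (0 < m)%N -> (forall i j, 0 <= A i j) -> eigenvalue (toC A) z ->
  normc z <= spectral_radius A.
Proof.
move=> m0 A0 zA; apply: ub_le_sup; last by exists z.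
by have [] := has_sup_eigenmoduli m0 A0.
Qed.

Lemma spectral_radius_ge0 m (A : 'M[R]_m) :
  (0 < m)%N -> (forall i j, 0 <= A i j) -> 0 <= spectral_radius A.
Proof.
move=> m0 A0; have [[_ [z /= zA _]] _] := has_sup_eigenmoduli m0 A0.
exact: le_trans (normc_ge0 z) (normc_le_spectral_radius m0 A0 zA).
Qed.

Lemma spectral_radius_le m (A : 'M[R]_m) (b : R) :
  (0 < m)%N -> (forall i j, 0 <= A i j) ->
  (forall z, eigenvalue (toC A) z -> normc z <= b) -> spectral_radius A <= b.
Proof.
move=> m0 A0 zb; have [ne _] := has_sup_eigenmoduli m0 A0.
by apply: ge_sup => // _ [z /= zA <-]; exact: zb.
Qed.

(** Over the complex numbers the characteristic polynomial splits into factors ['X - z%:P] with [z]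
    an eigenvalue, and it annihilates the matrix by Cayley-Hamilton. The strict inequality leaves
    room for the polynomial factors that Jordan blocks produce. *)
Lemma orbit_growth m (A : 'M[R]_m) (u : 'cV[R]_m) (r : R) :
  (0 < m)%N -> (forall i j, 0 <= A i j) -> spectral_radius A < r ->
  exists2 K, 0 <= K & forall n i, orbit A u n i 0 <= K * r ^+ n.
Proof.
case: m A u => // m A u _ A0 rho_r.
have [s Es] := closed_field_poly_normal (char_poly (toC A)).
move: Es; rewrite (monicP (char_poly_monic _)) scale1r => Es.
have [||K K0 HK] := @annihilated_orbit_growth _ (toC A) s _ r (toC u)
    (spectral_radius_ge0 (ltn0Sn m) A0) rho_r.
- move=> z zs; apply: normc_le_spectral_radius => //.
  by rewrite eigenvalue_root_char Es root_prod_XsubC.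
- by rewrite -Es Cayley_Hamilton mul0mx.
exists K => // n i; apply: le_trans (HK n i).
by rewrite -toC_orbit mxE normc_real ler_norm.
Qed.

(** * Logarithm and exponential in base 2 *)

Lemma ln_lt (x y : R) : 0 < x -> x < y -> ln x < ln y.
Proof. by move=> /RltP x0 /RltP xy; apply/RltP; exact: ln_increasing. Qed.

Lemma ln2_gt0 : 0 < ln 2.
Proof. by have := @ln_lt 1 2 ltr01 (ltr1n R 2); rewrite ln_1. Qed.

Lemma log2_le (x y : R) : 0 < x -> 0 < y -> (log2 x <= log2 y) = (x <= y).
Proof.
move=> x0 y0; rewrite ler_pM2r ?invr_gt0 ?ln2_gt0 //.
case: (ltgtP x y) => [xy|yx|->]; last by rewrite lexx.
  by apply/ltW/ln_lt.
by apply/negbTE; rewrite -ltNge; exact: ln_lt.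
Qed.

Lemma log2_lt (x y : R) : 0 < x -> 0 < y -> (log2 x < log2 y) = (x < y).
Proof. by move=> x0 y0; rewrite !ltNge log2_le. Qed.

Lemma log2M (x y : R) : 0 < x -> 0 < y -> log2 (x * y)%R = log2 x + log2 y.
Proof.
by move=> /RltP x0 /RltP y0; rewrite /log2 -mulrDl -RmultE ln_mult.
Qed.

Lemma log2_1 : log2 1%R = 0.
Proof. by rewrite /log2 -[1%R]R1E ln_1 mul0r. Qed.

Lemma log2X (x : R) n : 0 < x -> log2 (x ^+ n) = n%:R * log2 x.
Proof.
move=> x0; elim: n => [|n IH]; first by rewrite expr0 log2_1 mul0r.
by rewrite exprS log2M ?exprn_gt0 // IH -natr1; ring.
Qed.

Definition exp2 (x : R) : R := exp (x * ln 2).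

Lemma exp2_gt0 x : 0 < exp2 x.
Proof. by apply/RltP; exact: exp_pos. Qed.

Lemma exp2K x : log2 (exp2 x) = x.
Proof. by rewrite /log2 /exp2 ln_exp mulfK // gt_eqF ?ln2_gt0. Qed.

(** * Growth rates of real sequences *)

Lemma bernoulli (x : R) n : 0 <= x -> 1 + n%:R * x <= (1 + x) ^+ n.
Proof.
move=> x0; elim: n => [|n IH]; first by rewrite mul0r addr0.
rewrite exprS; apply: (@le_trans _ _ ((1 + x) * (1 + n%:R * x))).
  rewrite -natr1 -subr_ge0.
  have -> : (1 + x) * (1 + n%:R * x) - (1 + (n%:R + 1) * x) = n%:R * (x * x) by ring.
  by rewrite mulr_ge0 // mulr_ge0.
by rewrite ler_wpM2l // addr_ge0.
Qed.

(** If [b < a], the powers of [a / b] would be unbounded by Bernoulli's inequality. *)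
Lemma le_of_expr_le (K a b : R) :
  0 < b -> (forall n, a ^+ n <= K * b ^+ n) -> a <= b.
Proof.
move=> b0 H; rewrite leNgt; apply/negP => ab.
have K0 : 0 <= K by have := H 0%N; rewrite !expr0 mulr1; apply: le_trans.
pose x := a / b - 1.
have x0 : 0 < x by rewrite subr_gt0 ltr_pdivlMr // mul1r.
have := archi_boundP (divr_ge0 K0 (ltW x0)); set n := Num.bound _ => Hn.
have := le_trans (bernoulli n (ltW x0)) (_ : _ <= K).
have -> : 1 + x = a / b by rewrite /x; lra.
rewrite expr_div_n ler_pdivrMr ?exprn_gt0 // => /(_ (H n)).
by move: Hn; rewrite ltr_pdivrMr //; lra.
Qed.

(** Here [l] is the infimum of [a n / n] over positive [n]. For [s] above it, some quotient lies
    below [s]; Euclidean division by its index and subadditivity give the upper bound, the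
    remainders being absorbed in [K]. *)
Lemma fekete (a : nat -> R) :
  (forall n, 0 <= a n) -> (forall m n, a (m + n)%N <= a m + a n) ->
  exists l, (forall n, n%:R * l <= a n) /\
    forall s, l < s -> exists K, forall n, a n <= K + n%:R * s.
Proof.
move=> a0 aD; pose E : set R := [set a n.+1 / n.+1%:R | n in setT].
have E0 x : E x -> 0 <= x by move=> [n _ <-]; rewrite divr_ge0.
have infE : has_inf E.
  by split; [exists (a 1%N / 1%:R), 0%N | exists 0 => x /E0].
have l0 : 0 <= inf E by apply: lb_le_inf => //; have [] := infE.
exists (inf E); split=> [[|n]|s ls]; first by rewrite mul0r.
  rewrite mulrC -ler_pdivlMr ?ltr0n //; apply: ge_inf; last by exists n.
  by have [] := infE.
have [_ [m _ <-] ms] := inf_lt infE.1 ls.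
exists (\sum_(i < m.+1) a i) => n.
have aM q r : a (q * m.+1 + r)%N <= q%:R * a m.+1 + a r.
  elim: q => [|q IH]; first by rewrite mul0r add0r mul0n add0n.
  rewrite mulSn -addnA; apply: le_trans (aD _ _) _.
  by rewrite -natr1; lra.
rewrite (divn_eq n m.+1); apply: le_trans (aM _ _) _; rewrite addrC; apply: lerD.
  have lt_m : (n %% m.+1 < m.+1)%N by rewrite ltn_mod.
  by rewrite (bigD1 (Ordinal lt_m)) //= lerDl sumr_ge0.
have s0 : 0 <= s by apply: le_trans (ltW ls).
apply: (@le_trans _ _ ((n %/ m.+1 * m.+1)%:R * s)); last first.
  by rewrite ler_wpM2r // ler_nat leq_addr.
rewrite natrM -mulrA ler_wpM2l //; move: (ltW ms).
by rewrite ler_pdivrMr ?ltr0n // mulrC.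
Qed.

(** The divisor [n.+1] and the constant [c] match [h_seq], where words of length [n.+1] carry walks
    of [n] steps and an extra factor [#|I|]. *)
Lemma cvg_linear_growth (a : nat -> R) (c l : R) :
  (forall n, n%:R * l <= a n) ->
  (forall s, l < s -> exists K, forall n, a n <= K + n%:R * s) ->
  ((fun n => (c + a n) / n.+1%:R) @ \oo --> l).
Proof.
move=> lo hi; apply/(@cvgrPdist_le R R^o) => e e0.
have [K HK] := hi (l + e / 2) (ltac:(lra)).
(* The bounds on [a n] place [c + a n - n.+1%:R * l] between [c - l] and
   [c + K - l + n%:R * (e / 2)], so [B <= n%:R * (e / 2)] suffices. *)
pose B := `|c - l| + `|c + K - l|.
have B0 : 0 <= B by rewrite addr_ge0.
exists (Num.bound (B / (e / 2))) => // n /= Hn.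
have n0 : 0 < n.+1%:R :> R by rewrite ltr0n.
have Bn : B <= n%:R * (e / 2).
  rewrite -ler_pdivrMr; last lra.
  apply: le_trans (ltW (archi_boundP _)) _; first by rewrite divr_ge0 //; lra.
  by rewrite ler_nat.
have [h1 h2] : `|c - l| <= B /\ `|c + K - l| <= B by rewrite lerDl lerDr.
have := lo n; have := HK n.
move: h1 h2; rewrite !ler_norml => /andP[h1 h1'] /andP[h2 h2'] h3 h4.
have -> : l - (c + a n) / n.+1%:R = (l * n.+1%:R - (c + a n)) / n.+1%:R.
  by rewrite mulrBl mulfK // gt_eqF.
have nn0 : 0 <= n%:R :> R by [].
rewrite ler_pdivlMr // ler_pdivrMr // -natr1.
move: h3; set N := n%:R in Bn h4 nn0 *.
by move=> h3; have Ne : 0 <= N * e; [rewrite mulr_ge0 // ltW | apply/andP; split; lra].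
Qed.

(** * Spectral radius compared with growth rates *)

Lemma le_of_forall_gt (a b : R) : (forall r, b < r -> a <= r) -> a <= b.
Proof.
move=> H; rewrite leNgt; apply/negP => ba.
have := H ((a + b) / 2) (ltac:(lra)); lra.
Qed.

(** The coordinate [i] may vary with [n], since the bound of [orbit_growth] is uniform in the
    coordinates. *)
Lemma le_spectral_radius m (A : 'M[R]_m) (a : R) :
  (0 < m)%N -> (forall i j, 0 <= A i j) ->
  (forall n, exists i, a ^+ n <= orbit A (const_mx 1 : 'cV_m) n i 0) ->
  a <= spectral_radius A.
Proof.
move=> m0 A0 H; apply: le_of_forall_gt => r rho_r.
have [K K0 HK] := orbit_growth (const_mx 1) m0 A0 rho_r.
have r0 : 0 < r by apply: le_lt_trans (spectral_radius_ge0 m0 A0) rho_r.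
apply: (@le_of_expr_le K) => // n; have [i Hi] := H n.
exact: le_trans Hi (HK n i).
Qed.

(** For an eigenvalue [z] of [A] and any [s > lam], [r > spectral_radius B], the powers of [normc z]
    are at most a constant times those of [r * s]. So [normc z <= r * s], and [s], [r] decrease to
    their limits one after the other. *)
Lemma spectral_radius_le_mul m (A B : 'M[R]_m) (p : nat -> R) (lam : R) :
  (0 < m)%N -> (forall i j, 0 <= A i j) -> (forall i j, 0 <= B i j) ->
  0 < lam -> 0 < spectral_radius B -> (forall n, 0 <= p n) ->
  (forall s, lam < s -> exists K, forall n, p n <= K * s ^+ n) ->
  (forall n i, orbit A (const_mx 1 : 'cV_m) n i 0
               <= p n * orbit B (const_mx 1 : 'cV_m) n i 0) ->
  spectral_radius A <= spectral_radius B * lam.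
Proof.
move=> m0 A0 B0 lam0 rhoB p0 p_le AB; apply: spectral_radius_le => // z zA.
rewrite mulrC -ler_pdivrMr //; apply: le_of_forall_gt => s lam_s.
have s0 : 0 < s by apply: lt_trans lam_s.
rewrite ler_pdivrMr // mulrC -ler_pdivrMr //; apply: le_of_forall_gt => r rho_r.
have r0 : 0 < r by apply: lt_trans rho_r.
rewrite ler_pdivrMr //.
have [K HK] := p_le s lam_s.
have [L L0 HL] := orbit_growth (const_mx 1) m0 B0 rho_r.
apply: (@le_of_expr_le (K * L)); first exact: mulr_gt0.
move=> n; apply: (eigenvalue_orbit_le A0 zA) => i.
apply: le_trans (AB n i) _.
apply: (@le_trans _ _ (p n * (L * r ^+ n))); first by rewrite ler_wpM2l.
have -> : K * L * (r * s) ^+ n = K * s ^+ n * (L * r ^+ n).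
  by rewrite exprMn; ring.
by rewrite ler_wpM2r // mulr_ge0 // exprn_ge0 // ltW.
Qed.

(** * Weights of walks in a finite graph *)

(* The last vertex of a walk does not contribute its out-degree: the factor of
   [Nspan] at the last time is the number of possible first letters instead. *)
Fixpoint walk_weight (I : finType) (D : I -> {set I}) (n : nat) (A : I) : nat :=
  if n is n'.+1 then (#|D A| * \max_(B in D A) walk_weight D n' B)%N else 1%N.

Definition max_weight (I : finType) (D : I -> {set I}) (n : nat) : nat :=
  (\max_A walk_weight D n A)%N.

Lemma walk_weight_le (I : finType) (D : I -> {set I}) n A :
  (walk_weight D n A <= max_weight D n)%N.
Proof. exact: (leq_bigmax_cond (F := walk_weight D n)). Qed.

Lemma walk_weight_gt0 (I : finType) (D : I -> {set I}) n A :
  (forall A, D A != finset.set0) -> (0 < walk_weight D n A)%N.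
Proof.
move=> D0; elim: n A => //= n IH A; rewrite muln_gt0 card_gt0 D0 /=.
have /set0Pn[B BA] := D0 A.
exact: leq_trans (IH B) (leq_bigmax_cond (F := walk_weight D n) _ BA).
Qed.

(** Cut the walk after [m] steps: the remaining [n] steps weigh at most [max_weight D n], wherever
    they start. *)
Lemma walk_weightD (I : finType) (D : I -> {set I}) m n A :
  (walk_weight D (m + n) A <= walk_weight D m A * max_weight D n)%N.
Proof.
elim: m A => [|m IH] A; first by rewrite mul1n walk_weight_le.
rewrite addSn /= -mulnA leq_mul2l; apply/orP; right.
apply/bigmax_leqP => B BA; apply: leq_trans (IH B) _; rewrite leq_mul2r.
by apply/orP; right; exact: (leq_bigmax_cond (F := walk_weight D m)).
Qed.

Lemma max_weightD (I : finType) (D : I -> {set I}) m n :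
  (max_weight D (m + n) <= max_weight D m * max_weight D n)%N.
Proof.
apply/bigmax_leqP => A _; apply: leq_trans (walk_weightD _ _ _ _) _.
by rewrite leq_mul2r walk_weight_le orbT.
Qed.

Lemma max_weight_gt0 (I : finType) (D : I -> {set I}) n (A : I) :
  (forall A, D A != finset.set0) -> (0 < max_weight D n)%N.
Proof. by move=> D0; apply: leq_trans (walk_weight_le D n A); exact: walk_weight_gt0. Qed.

Lemma exists_max_weight (I : finType) (D : I -> {set I}) n (A : I) :
  exists B, walk_weight D n B = max_weight D n.
Proof.
have I0 : (0 < #|I|)%N by apply/card_gt0P; exists A.
by have [B E] := bigop.eq_bigmax (walk_weight D n) I0; exists B; rewrite -E.
Qed.

Lemma prod_path_le (I : finType) (D : I -> {set I}) x0 x (s : seq I) n :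
  size s = n -> path (fun A B => B \in D A) x s ->
  (\prod_(t < n) #|D (nth x0 (x :: s) t)| <= walk_weight D n x)%N.
Proof.
move=> <-; elim: s x => [|y s IH] x /=; first by rewrite big_ord0.
case/andP => xy /IH le_y; rewrite big_ord_recl /= leq_mul2l; apply/orP; right.
exact: leq_trans le_y (leq_bigmax_cond (F := walk_weight D (size s)) _ xy).
Qed.

(** A fixed choice of successor, used to prolong walks; the default [A] is never reached when all
    [D A] are nonempty. *)
Definition some_succ (I : finType) (D : I -> {set I}) (A : I) : I :=
  odflt A [pick B in D A].

Lemma some_succP (I : finType) (D : I -> {set I}) A :
  D A != finset.set0 -> some_succ D A \in D A.
Proof.
by case/set0Pn=> B BA; rewrite /some_succ; case: pickP => //= /(_ B); rewrite BA.
Qed.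

Lemma path_traject (I : finType) (D : I -> {set I}) A n :
  (forall A, D A != finset.set0) ->
  path (fun A B => B \in D A) A (traject (some_succ D) (some_succ D A) n).
Proof. by move=> D0; elim: n A => //= n IH A; rewrite some_succP //= IH. Qed.

(** * Lower bound for every spanning set *)

Lemma Pset_last (I : finType) n (S : {set n.+1.-tuple I}) a :
  Pset S a n = [set A | [exists b in S, nth A b 0 == A]]%SET.
Proof. by rewrite /Pset ltnn. Qed.

Lemma Pset_before (I : finType) n (S : {set n.+1.-tuple I}) a t : (t < n)%N ->
  Pset S a t =
  [set A | [exists b in S, (take t.+1 b == take t.+1 a) && (nth A b t.+1 == A)]]%SET.
Proof. by move=> tn; rewrite /Pset ltnS tn. Qed.

Lemma eq_Pset (I : finType) n (S : {set n.+1.-tuple I}) (a b : n.+1.-tuple I) t :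
  (t < n)%N -> take t.+1 a = take t.+1 b -> Pset S a t = Pset S b t.
Proof. by move=> tn ab; rewrite !Pset_before // ab. Qed.

(* Greedy choice: after [k] steps of the optimal walk, [S] has a word following it,
   since every set [Pset S a k] contains all successors of [a k]. *)
Lemma walk_weight_le_prod_Pset (I : finType) (D : I -> {set I}) n
    (S : {set n.+1.-tuple I}) x0 A :
  (forall A, D A != finset.set0) ->
  (exists2 a, a \in S & nth x0 a 0 = A) ->
  (forall a t, a \in S -> (t < n)%N -> D (nth x0 a t) \subset Pset S a t) ->
  exists2 a, a \in S & (walk_weight D n A <= \prod_(t < n) #|Pset S a t|)%N.
Proof.
move=> D0 [a0 a0S a0A] DP.
suff H k : (k <= n)%N -> exists2 a, a \in S &
    (walk_weight D n A <=
     (\prod_(t < k) #|Pset S a t|) * walk_weight D (n - k) (nth x0 a k))%N.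
  by have [a aS] := H n (leqnn n); rewrite subnn muln1; exists a.
elim: k => [|k IH] kn; first by exists a0 => //; rewrite big_ord0 mul1n subn0 a0A.
have [a aS le_a] := IH (ltnW kn).
move: le_a; rewrite -(subnSK kn) /=.
set E := D (nth x0 a k).
have E0 : (0 < #|E|)%N by rewrite card_gt0 D0.
have [B BE ->] := @bigop.eq_bigmax_cond _ (mem E) (walk_weight D (n - k.+1)) E0.
have := DP a k aS kn; rewrite -/E => EP.
have /fintype.subsetP/(_ B BE) := EP; rewrite Pset_before // inE.
case/existsP=> b /and3P[bS /eqP ba /eqP bB] le_a.
exists b => //; apply: leq_trans le_a _.
have -> : nth x0 b k.+1 = B.
  by rewrite -[RHS]bB; apply: set_nth_default; rewrite size_tuple.
rewrite mulnA leq_mul2r; apply/orP; right.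
rewrite big_ord_recr /= leq_mul //.
  (* [b] agrees with [a] up to index [k], so the factors already collected do not change. *)
  apply: eq_leq; apply: eq_bigr => t _; congr #|pred_of_set _|; apply: eq_Pset.
    exact: ltn_trans (ltn_ord t) kn.
  by rewrite -(@take_takel _ t.+1 k.+1) 1?ltnW ?ltnS // -ba take_takel // ltnW ?ltnS.
by rewrite (eq_Pset _ kn ba) subset_leq_card.
Qed.

Lemma DsetP (X U : Type) (F : X -> U -> set X) (I : finType) (cov : I -> set X)
    (G : I -> U) (A B : I) :
  reflect (exists y, Fimg F cov G A y /\ cov B y) (B \in Dset F cov G A).
Proof. by rewrite inE; exact: asboolP. Qed.

Lemma Dset_neq0 (X U : Type) (F : X -> U -> set X) (I : finType)
    (cov : I -> set X) (G : I -> U) (Q : set X) :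
  (forall x u, F x u !=set0) -> quasi_invariant_partition F cov G Q ->
  forall A, Dset F cov G A != finset.set0.
Proof.
move=> F0 [[_ [_ [Qcov FQ]]] [priv _]] A.
have [x [Ax _]] := priv A; have [y Fy] := F0 x (G A).
have Ay : Fimg F cov G A y by exists x.
have [B _ By] := Qcov y (FQ A y Ay).
by apply/set0Pn; exists B; apply/DsetP; exists y.
Qed.

(** Each [A] has a point of [Q] that no other cover element contains, so covering [Q] forces [A] to
    occur as a first letter. *)
Lemma Pset_full (X U : Type) (F : X -> U -> set X) (I : finType)
    (cov : I -> set X) (G : I -> U) (Q : set X) n (S : {set n.+1.-tuple I}) a :
  quasi_invariant_partition F cov G Q -> spanning F cov G Q S ->
  forall A, A \in Pset S a n.
Proof.
move=> [[_ [covQ _]] [priv _]] [S1 _] A.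
have [x [Ax Aonly]] := priv A.
have [B BP Bx] := S1 a x (covQ A x Ax).
by have [<-//|/eqP/Aonly/(_ Bx)] := eqVneq B A.
Qed.

(* By the second partition condition some point of [F(A, G A)] lying in [B] lies in
   no other element of [D(A)], so only [B] itself can cover it. *)
Lemma Dset_sub_Pset (X U : Type) (F : X -> U -> set X) (I : finType)
    (cov : I -> set X) (G : I -> U) (Q : set X) n (S : {set n.+1.-tuple I})
    (a : n.+1.-tuple I) (x0 : I) t :
  quasi_invariant_partition F cov G Q -> spanning F cov G Q S -> a \in S ->
  (t < n)%N -> Dset F cov G (nth x0 a t) \subset Pset S a t.
Proof.
move=> [_ [_ qip]] [_ S2] aS tn; apply/fintype.subsetP => B BD.
have [y [Ay [By Bonly]]] := qip _ B BD.
have tn1 : (t < n.+1)%N by apply: ltnW.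
have := S2 a aS (Ordinal tn1) tn y; rewrite (tnth_nth x0) => /(_ Ay)[C CP Cy].
have CD : C \in Dset F cov G (nth x0 a t) by apply/DsetP; exists y.
by have [<-//|/eqP/(Bonly C CD)/(_ Cy)] := eqVneq C B.
Qed.

(** Some word of [S] begins where an optimal walk begins. The greedy choice then makes the first [n]
    factors multiply to at least [max_weight], and the last factor is [#|I|]. *)
Lemma Nspan_ge (X U : Type) (F : X -> U -> set X) (I : finType)
    (cov : I -> set X) (G : I -> U) (Q : set X) n (S : {set n.+1.-tuple I}) (x0 : I) :
  (forall x u, F x u !=set0) ->
  quasi_invariant_partition F cov G Q -> spanning F cov G Q S ->
  (#|I| * max_weight (Dset F cov G) n <= Nspan S)%N.
Proof.
move=> F0 qip spS.
have [A <-] := exists_max_weight (Dset F cov G) n x0.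
(* The constant word is arbitrary: at the last time [Pset] does not depend on the word. *)
have := Pset_full (nseq_tuple n.+1 x0) qip spS A.
rewrite Pset_last inE => /existsP[b /andP[bS /eqP bA]].
have [a aS le_a] : exists2 a, a \in S &
    (walk_weight (Dset F cov G) n A <= \prod_(t < n) #|Pset S a t|)%N.
  apply: (@walk_weight_le_prod_Pset _ _ _ _ x0); first exact: Dset_neq0 F0 qip.
    by exists b => //; rewrite -[RHS]bA; apply: set_nth_default; rewrite size_tuple.
  by move=> a t aS tn; exact: Dset_sub_Pset qip spS aS tn.
apply: leq_trans (leq_bigmax_cond (F := fun a => \prod_(t < n.+1) #|Pset S a t|)%N _ aS).
rewrite big_ord_recr /= mulnC leq_mul // subset_leq_card //.
by apply/fintype.subsetP => B _; exact: Pset_full qip spS B.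
Qed.

(** * The set of all walks is an optimal spanning set *)

Definition walks (I : finType) (D : I -> {set I}) n : {set n.+1.-tuple I} :=
  [set a : n.+1.-tuple I | path (fun A B => B \in D A) (thead a) (behead a)]%SET.

Lemma walk_nth (I : finType) (D : I -> {set I}) n (a : n.+1.-tuple I) x0 t :
  a \in walks D n -> (t < n)%N -> nth x0 a t.+1 \in D (nth x0 a t).
Proof.
rewrite inE; case/tupleP: a => x s /=; rewrite theadE => /(pathP x0) xs tn.
by apply: xs; rewrite size_tuple.
Qed.

Lemma exists_walk_from (I : finType) (D : I -> {set I}) n A :
  (forall A, D A != finset.set0) -> exists2 a, a \in walks D n & nth A a 0 = A.
Proof.
move=> D0; pose s := traject (some_succ D) (some_succ D A) n.
have szs : size (A :: s) == n.+1 by rewrite /= size_traject.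
by exists (Tuple szs) => //; rewrite inE /= path_traject.
Qed.

(** Keep the letters up to time [t], append [B] and prolong by arbitrary successors: the result is
    again a walk. *)
Lemma Dset_sub_Pset_walks (I : finType) (D : I -> {set I}) n (a : n.+1.-tuple I) x0 t :
  (forall A, D A != finset.set0) -> a \in walks D n -> (t < n)%N ->
  D (nth x0 a t) \subset Pset (walks D n) a t.
Proof.
move=> D0 aW tn; apply/fintype.subsetP => B BD; rewrite Pset_before // inE.
pose s := take t.+1 a ++ traject (some_succ D) B (n - t).
have sz_take : size (take t.+1 a) = t.+1 by rewrite size_takel // size_tuple ltnW.
have szs : size s == n.+1.
  by rewrite size_cat sz_take size_traject addSn subnKC // ltnW.
apply/existsP; exists (Tuple szs).
have s_take : take t.+1 s = take t.+1 a by rewrite take_size_cat.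
have s_nth : nth B s t.+1 = B.
  rewrite nth_cat sz_take ltnn subnn.
  by case: (n - t)%N (subn_gt0 t n) => //; rewrite tn.
rewrite /= s_take s_nth !eqxx !andbT.
move: aW; rewrite !inE; case/tupleP: a BD @s sz_take szs s_take s_nth => x a BD s _ szs _ _.
rewrite /thead /= (tnth_nth x) /= (tnth_nth x) /= => xa.
rewrite cat_path (take_path t xa) /=.
have -> : last x (take t a) = nth x (x :: a) t.
  have sz_t : size (take t a) = t by rewrite size_takel // size_tuple ltnW.
  by rewrite (last_nth x) sz_t -[RHS](nth_take x (ltnSn t)).
have -> : nth x (x :: a) t = nth x0 (x :: a) t.
  by apply: set_nth_default; rewrite /= size_tuple ltnW.
case: (n - t)%N => //= k; rewrite path_traject // andbT; exact: BD.
Qed.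

Lemma Pset_walks_sub (I : finType) (D : I -> {set I}) n (a : n.+1.-tuple I) x0 t :
  (t < n)%N -> Pset (walks D n) a t \subset D (nth x0 a t).
Proof.
move=> tn; apply/fintype.subsetP => B; rewrite Pset_before // inE.
case/existsP=> b /and3P[bW /eqP ba /eqP <-].
rewrite -(nth_take x0 (ltnSn t)) -ba nth_take //.
have <- : nth x0 b t.+1 = nth B b t.+1.
  by apply: set_nth_default; rewrite size_tuple.
exact: walk_nth.
Qed.

Lemma spanning_walks (X U : Type) (F : X -> U -> set X) (I : finType)
    (cov : I -> set X) (G : I -> U) (Q : set X) n :
  (forall x u, F x u !=set0) -> quasi_invariant_partition F cov G Q ->
  spanning F cov G Q (walks (Dset F cov G) n).
Proof.
move=> F0 qip; have D0 := Dset_neq0 F0 qip.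
have [[_ [_ [Qcov FQ]]] _] := qip.
split=> [a x Qx|a aW t tn y Fy].
  have [A _ Ax] := Qcov x Qx; exists A => //=.
  rewrite Pset_last inE; have [b bW bA] := exists_walk_from n A D0.
  by apply/existsP; exists b; rewrite bW bA /=.
have [B _ By] := Qcov y (FQ _ y Fy); exists B => //=.
apply: (fintype.subsetP (Dset_sub_Pset_walks (tnth a t) D0 aW tn)).
by apply/DsetP; exists y; split; rewrite // -tnth_nth.
Qed.

Lemma Nspan_walks_le (I : finType) (D : I -> {set I}) n :
  (Nspan (walks D n) <= #|I| * max_weight D n)%N.
Proof.
apply/bigmax_leqP => a aW; rewrite big_ord_recr /= mulnC leq_mul ?max_card //.
apply: leq_trans (walk_weight_le D n (thead a)).
move: aW; case/tupleP: a => x s /[dup] aW; rewrite inE theadE /= => xs.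
apply: leq_trans (prod_path_le x (size_tuple s) xs).
apply: leq_prod => t _; apply: subset_leq_card.
exact: (@Pset_walks_sub _ _ _ [tuple of x :: s] x).
Qed.

(** The infimum is attained at [walks], where the upper bound on [Nspan] meets the lower bound valid
    for all spanning sets. *)
Lemma r_invE (X U : Type) (F : X -> U -> set X) (I : finType)
    (cov : I -> set X) (G : I -> U) (Q : set X) n (x0 : I) :
  (forall x u, F x u !=set0) -> quasi_invariant_partition F cov G Q ->
  r_inv F cov G Q n.+1 = (#|I| * max_weight (Dset F cov G) n)%:R.
Proof.
move=> F0 qip; have spW := spanning_walks n F0 qip.
rewrite /r_inv; set D := Dset F cov G in spW *; set E := (X in inf X).
have EW : E (Nspan (walks D n))%:R by exists (walks D n).
have lbE : lbound E (#|I| * max_weight D n)%:R.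
  by move=> _ [S [spS ->]]; rewrite ler_nat; exact: Nspan_ge x0 F0 qip spS.
apply/eqP; rewrite eq_le; apply/andP; split; last first.
  by apply: lb_le_inf => //; exists (Nspan (walks D n))%:R.
apply: (@le_trans _ _ (Nspan (walks D n))%:R); last by rewrite ler_nat Nspan_walks_le.
by apply: ge_inf => //; exists (#|I| * max_weight D n)%:R.
Qed.

(** * Row sums of powers of the adjacency matrices *)

(** Common form of both matrices: [c = 1] gives [adj_mx], and [c A = #|D A|] gives [wadj_mx]. *)
Definition weighted_adj (I : finType) (D : I -> {set I}) (c : I -> R) : 'M[R]_#|I| :=
  \matrix_(i, j) (if enum_val j \in D (enum_val i) then c (enum_val i) else 0).

Local Notation rowsum D c n A :=
  (orbit (weighted_adj D c) (const_mx 1 : 'cV_ _) n (enum_rank A) 0).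

Lemma weighted_adj_ge0 (I : finType) (D : I -> {set I}) (c : I -> R) :
  (forall A, 0 <= c A) -> forall i j, 0 <= weighted_adj D c i j.
Proof. by move=> c0 i j; rewrite mxE; case: ifP. Qed.

Lemma rowsumS (I : finType) (D : I -> {set I}) (c : I -> R) n A :
  rowsum D c n.+1 A = c A * \sum_(B in D A) rowsum D c n B.
Proof.
rewrite /= mxE (reindex _ (onW_bij _ (@enum_rank_bij I))) /= mulr_sumr.
rewrite [RHS]big_mkcond; apply: eq_bigr => B _.
by rewrite [weighted_adj D c _ _]mxE !enum_rankK; case: ifP; rewrite ?mul0r.
Qed.

Lemma rowsum0 (I : finType) (D : I -> {set I}) (c : I -> R) A :
  rowsum D c 0 A = 1.
Proof. by rewrite /= mxE. Qed.

Lemma rowsum_ge0 (I : finType) (D : I -> {set I}) (c : I -> R) n A :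
  (forall A, 0 <= c A) -> 0 <= rowsum D c n A.
Proof.
move=> c0; elim: n A => [|n IH] A; first by rewrite rowsum0.
by rewrite rowsumS mulr_ge0 // sumr_ge0.
Qed.

Lemma rowsum_ge1 (I : finType) (D : I -> {set I}) (c : I -> R) n A :
  (forall A, D A != finset.set0) -> (forall A, 1 <= c A) -> 1 <= rowsum D c n A.
Proof.
move=> D0 c1; have c0 B : 0 <= c B by apply: le_trans (c1 B).
elim: n A => [|n IH] A; first by rewrite rowsum0.
have /set0Pn[B BA] := D0 A.
rewrite rowsumS (bigD1 B) //= -[leLHS]mulr1; apply: ler_pM => //.
by rewrite (le_trans (IH B)) // lerDl sumr_ge0 // => C _; exact: rowsum_ge0.
Qed.

(** The row sum adds the weights of all walks of length [n] from [A], hence dominates the largest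
    one. *)
Lemma walk_weight_le_rowsum (I : finType) (D : I -> {set I}) n A :
  (forall A, D A != finset.set0) ->
  (walk_weight D n A)%:R <= rowsum D (fun A => #|D A|%:R) n A.
Proof.
move=> D0; elim: n A => [|n IH] A; first by rewrite rowsum0.
rewrite rowsumS /= natrM ler_wpM2l //.
have A0 : (0 < #|D A|)%N by rewrite card_gt0.
have [B BA ->] := bigop.eq_bigmax_cond (walk_weight D n) A0.
by rewrite (bigD1 B) //= (le_trans (IH B)) // lerDl sumr_ge0 // => C _; exact: rowsum_ge0.
Qed.

(** With [c = 1] the row sum counts the walks, each of which weighs at most [walk_weight D n A]. *)
Lemma rowsum_le_walk_weight (I : finType) (D : I -> {set I}) n A :
  rowsum D (fun A => #|D A|%:R) n A <=
  (walk_weight D n A)%:R * rowsum D (fun _ => 1) n A.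
Proof.
elim: n A => [|n IH] A; first by rewrite !rowsum0 mul1r.
rewrite !rowsumS mul1r /= natrM -mulrA ler_wpM2l // mulr_sumr.
apply: ler_sum => B BA; apply: le_trans (IH B) _.
rewrite ler_wpM2r ?rowsum_ge0 // ler_nat.
exact: (leq_bigmax_cond (F := walk_weight D n)).
Qed.

Lemma mx_norm_inf_ge n (M : 'M[R]_n) i j : `|M i j| <= mx_norm_inf M.
Proof.
apply: le_trans (le_bigmax 0 (fun j => `|M i j|) j) _.
exact: (le_bigmax 0 (fun i => \big[Num.max/0]_(j < n) `|M i j|) i).
Qed.

Lemma card_le_mx_norm_inf (I : finType) (D : I -> {set I}) A :
  (forall A, D A != finset.set0) ->
  #|D A|%:R <= mx_norm_inf (weighted_adj D (fun A => #|D A|%:R)).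
Proof.
move=> D0; have /set0Pn[B BA] := D0 A.
apply: le_trans (mx_norm_inf_ge _ (enum_rank A) (enum_rank B)).
by rewrite mxE !enum_rankK BA ler_norm.
Qed.

Lemma walk_weight_le_expr (I : finType) (D : I -> {set I}) (b : R) n A :
  (forall A, #|D A|%:R <= b) -> (walk_weight D n A)%:R <= b ^+ n.
Proof.
move=> Db; have b0 : 0 <= b by apply: le_trans (Db A).
elim: n A => [|n IH] A //=; rewrite natrM exprS ler_pM //.
by elim/big_ind: _ => [|x y xb yb|B _]; rewrite ?exprn_ge0 //; case: (leqP x y).
Qed.

(** * Exponential growth rate of the maximal weight, and the entropy bounds *)

(** Fekete's lemma applied to the logarithms, then exponentiated; they are nonnegative because every
    weight is at least 1. *)
Lemma max_weight_growth (I : finType) (D : I -> {set I}) (A0 : I) :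
  (forall A, D A != finset.set0) ->
  exists l : R, [/\
    forall c, (fun n => (c + log2 (max_weight D n)%:R) / n.+1%:R) @ \oo --> l,
    forall n, exp2 l ^+ n <= (max_weight D n)%:R &
    forall s, exp2 l < s -> exists K, forall n, (max_weight D n)%:R <= K * s ^+ n].
Proof.
move=> D0.
have p0 n : 0 < (max_weight D n)%:R :> R by rewrite ltr0n (max_weight_gt0 n A0).
have [||l [lo hi]] := @fekete (fun n => log2 (max_weight D n)%:R).
- by move=> n; rewrite -log2_1 log2_le // ler1n (max_weight_gt0 n A0).
- by move=> m n; rewrite -log2M // log2_le ?mulr_gt0 // -natrM ler_nat max_weightD.
exists l; split=> [c|n|s ls]; first exact: cvg_linear_growth.
  by rewrite -log2_le ?exprn_gt0 ?exp2_gt0 // log2X ?exp2_gt0 // exp2K.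
have s0 : 0 < s by apply: lt_trans (exp2_gt0 l) ls.
have [|K HK] := hi (log2 s); first by rewrite -[l]exp2K log2_lt ?exp2_gt0.
exists (exp2 K) => n; have sn0 : 0 < s ^+ n by rewrite exprn_gt0.
by rewrite -log2_le ?mulr_gt0 ?exp2_gt0 // log2M ?exp2_gt0 // exp2K log2X.
Qed.

Unset Implicit Arguments.

Theorem theorem3p6 (X U : Type) (F : X -> U -> set X)
  (I : finType) (cov : I -> set X) (G : I -> U) (Q : set X) :
  (forall x u, F x u !=set0) ->
  Q !=set0 ->
  quasi_invariant_partition F cov G Q ->
  let M := adj_mx F cov G in
  let W := wadj_mx F cov G in
  let h := h_inv F cov G Q in
  cvg (h_seq F cov G Q @ \oo) /\
  log2 (spectral_radius W) - log2 (spectral_radius M) <= h /\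
  h <= Num.min (log2 (mx_norm_inf W)) (log2 (spectral_radius W)) /\
  (spectral_radius M = 1 -> h = log2 (spectral_radius W)).
Proof.
move=> F0 [x Qx] qip M W h.
have D0 := Dset_neq0 F0 qip.
have [A0 _ _] : (\bigcup_(A in [set: I]) cov A) x by case: qip => [[_ [_ [+ _]]] _]; apply.
have I0 : (0 < #|I|)%N by apply/card_gt0P; exists A0.
set D := Dset F cov G in D0.
have ME : M = weighted_adj D (fun _ => 1) by [].
have WE : W = weighted_adj D (fun A => #|D A|%:R) by [].
have [l [h_cvg l_lo l_hi]] := max_weight_growth A0 D0.
have hl : h_seq F cov G Q @ \oo --> l.
  have -> : h_seq F cov G Q =
      fun n => (log2 #|I|%:R + log2 (max_weight D n)%:R) / n.+1%:R; last exact: h_cvg.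
  apply/funext => n; rewrite /h_seq (r_invE n A0 F0 qip) natrM log2M ?ltr0n //.
  exact: (max_weight_gt0 n A0 D0).
have hE : h = l by exact: (@cvg_lim R^o).
clearbody M W h.
have M0 : forall i j, 0 <= M i j by rewrite ME; exact: weighted_adj_ge0.
have W0 : forall i j, 0 <= W i j by rewrite WE; exact: weighted_adj_ge0.
have c1 A : 1 <= #|D A|%:R :> R by rewrite ler1n card_gt0.
(* Every vertex has a successor, so all row sums of powers are at least 1; positivity makes the
   logarithms below genuine. *)
have rhoM : 0 < spectral_radius M.
  apply: lt_le_trans ltr01 _; apply: le_spectral_radius => // n.
  by exists (enum_rank A0); rewrite expr1n ME rowsum_ge1.
have rhoW : 0 < spectral_radius W.
  apply: lt_le_trans ltr01 _; apply: le_spectral_radius => // n.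
  by exists (enum_rank A0); rewrite expr1n WE rowsum_ge1.
have lower : log2 (spectral_radius W) - log2 (spectral_radius M) <= h.
  have l0 := exp2_gt0 l.
  rewrite lerBlDl hE -[l]exp2K -(log2M rhoM l0) (log2_le rhoW (mulr_gt0 rhoM l0)).
  apply: (spectral_radius_le_mul I0 W0 M0 l0 rhoM (p := fun n => (max_weight D n)%:R)) => //.
  move=> n k; rewrite -[k]enum_valK WE ME.
  apply: le_trans (rowsum_le_walk_weight _ _ _) _.
  by rewrite ler_wpM2r ?rowsum_ge0 // ler_nat walk_weight_le.
have upper : h <= log2 (spectral_radius W).
  rewrite hE -[l]exp2K (log2_le (exp2_gt0 l) rhoW); apply: le_spectral_radius => // n.
  (* The best starting vertex depends on [n], which [le_spectral_radius] allows. *)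
  have [A EA] := exists_max_weight D n A0; exists (enum_rank A).
  by apply: le_trans (l_lo n) _; rewrite -EA WE walk_weight_le_rowsum.
have upper_norm : h <= log2 (mx_norm_inf W).
  have W1 : 1 <= mx_norm_inf W.
    by apply: le_trans (c1 A0) _; rewrite WE card_le_mx_norm_inf.
  have Wgt0 : 0 < mx_norm_inf W by apply: lt_le_trans W1.
  rewrite hE -[l]exp2K (log2_le (exp2_gt0 l) Wgt0); apply: (@le_of_expr_le 1) => // n.
  have [A EA] := exists_max_weight D n A0.
  rewrite mul1r; apply: le_trans (l_lo n) _; rewrite -EA walk_weight_le_expr // => B.
  by rewrite WE card_le_mx_norm_inf.
split; first by apply/cvg_ex; exists l.
split=> //; split; first by rewrite le_min upper_norm upper.
move=> rhoM1; apply/eqP; rewrite eq_le upper /=.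
by move: lower; rewrite rhoM1 log2_1 subr0.
Qed.
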